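(* Let $m\ge2$ be even. The ring $K_0(\mathcal{A}_{4m})$ has the following fusion rules, where $i,j\in\{1,\dots,m/2-1\}$ and $\varepsilon,\delta,\alpha,\beta\in\{1,-1\}$: $$\pi^\varepsilon_i(u,v)\otimes\pi^{+1}_j(x,y)=\begin{cases}\pi^{\varepsilon}_{i-j}(uy,vx)\oplus\pi^{\varepsilon}_{i+j}(ux,vy)& i+j\le m/2-1,\ i-j\ge0\\ \pi^{\varepsilon}_{j-i}(vx,uy)\oplus\pi^{\varepsilon}_{i+j}(ux,vy)& i+j\le m/2-1,\ i-j\le0\\ \pi^{\varepsilon}_{i-j}(uy,vx)\oplus\pi^{\varepsilon}_{m-i-j}(vy,ux)& i+j>m/2-1,\ i-j\ge0\\ \pi^{\varepsilon}_{j-i}(vx,uy)\oplus\pi^{\varepsilon}_{m-i-j}(vy,ux)& i+j>m/2-1,\ i-j\le0,\end{cases}$$ $$\pi^\varepsilon_i(u,v)\otimes\pi^{-1}_j(x,y)=\begin{cases}\pi^{-\varepsilon}_{i-j}(\lambda^ivy,ux)\oplus\pi^{-\varepsilon}_{i+j}(\lambda^ivx,uy)& i+j\le m/2-1,\ i-j\ge0\\ \pi^{-\varepsilon}_{j-i}(ux,\lambda^ivy)\oplus\pi^{-\varepsilon}_{i+j}(\lambda^ivx,uy)& i+j\le m/2-1,\ i-j\le0\\ \pi^{-\varepsilon}_{i-j}(\lambda^ivy,ux)\oplus\pi^{-\varepsilon}_{m-i-j}(uy,\lambda^ivx)& i+j>m/2-1,\ i-j\ge0\\ \pi^{-\varepsilon}_{j-i}(ux,\lambda^ivy)\oplus\pi^{-\varepsilon}_{m-i-j}(uy,\lambda^ivx)&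 i+j>m/2-1,\ i-j\le0,\end{cases}$$ $$T_{\alpha,\alpha,\varepsilon}(t)\otimes\pi^\delta_i(u,v)=\pi^{\varepsilon\delta}_i(tu,\alpha tv),\qquad \pi^\delta_i(u,v)\otimes T_{\alpha,\alpha,1}(t)=\pi^\delta_i(ut,\alpha vt),$$ $$\pi^\delta_i(u,v)\otimes T_{\alpha,\alpha,-1}(t)=\pi^{-\delta}_i(\lambda^ivt,\alpha ut),\qquad T_{\alpha,-\alpha,\varepsilon}(t)\otimes\pi^\delta_i(u,v)=\pi^{\varepsilon\delta}_{m/2-i}(\alpha\delta tv,tu),$$ $$\pi^\delta_i(u,v)\otimes T_{\alpha,-\alpha,1}(t)=\pi^\delta_{m/2-i}(\alpha vt,ut),\qquad \pi^\delta_i(u,v)\otimes T_{\alpha,-\alpha,-1}(t)=\pi^{-\delta}_{m/2-i}(\alpha ut,\lambda^ivt),$$ $$T_{\alpha,\alpha,\varepsilon}(t)\otimes T_{\beta,\beta,\delta}(s)=T_{\alpha\beta,\alpha\beta,\varepsilon\delta}(ts),\qquad T_{\alpha,-\alpha,\varepsilon}(t)\otimes T_{\beta,-\beta,\delta}(s)=T_{\alpha\beta\delta,\alpha\beta\delta,\varepsilon\delta}(ts),$$ $$T_{\alpha,\alpha,\varepsilon}(t)\otimes T_{\beta,-\beta,\delta}(s)=T_{\alpha\beta,-\alpha\beta,\varepsilon\delta}(ts),\qquad T_{\alpha,-\alpha,\varepsilon}(t)\otimes T_{\beta,\beta,\delta}(s)=T_{\alpha\beta\delta,-\alpha\beta\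delta,\varepsilon\delta}(ts).$$
   Context: Ground field $\Bbbk=\mathbb{C}$. $K_0(H)$ is the Grothendieck ring of finite-dimensional left $H$-modules, with product given by tensor product. $\mathcal{A}_{4m}$ (Masuoka), $m\ge2$: generated by $a,s_+,s_-$ with $a$ central and grouplike, $a^2=1$, $s_\pm^2=1$, $(s_+s_-)^m=1$. With $e_0=(1+a)/2$, $e_1=(1-a)/2$: $\Delta(s_\pm)=s_\pm\otimes e_0s_\pm+s_\mp\otimes e_1s_\pm$, $\epsilon(s_\pm)=1$, $S(s_\pm)=e_0s_\pm+e_1s_\mp$. It has dimension $4m$. Let $\lambda=e^{2\pi\sqrt{-1}/m}$. $T_{c_1,c_2,c_3}(t)$ is the one-dimensional module $\Bbbk t$ on which $s_+,s_-,a$ act by $c_1,c_2,c_3$. For $0\le i\le m/2$ and $\varepsilon=\pm1$, $\pi_i^\varepsilon(u,v)$ is the two-dimensional module with ordered basis $u,v$ and $s_+u=v$, $s_+v=u$, $s_-u=\lambda^iv$, $s_-v=\lambda^{-i}u$, $a$ acting by $\varepsilon$ (the modules $\pi^\varepsilon_0$ and $\pi^\varepsilon_{m/2}$ are reducible). An equality such as $M\otimes N=\pi(U,V)\oplus\pi(U',V')$ means that $M\otimes N$ is the direct sum of the submodules with the displayed ordered bases, on which the generators act by the formulas of the named module. We write $ux$ for $u\otimes x$, etc. *)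

(* Defs.v *)
From HB Require Import structures.
From mathcomp Require Import all_boot all_order all_algebra.
From mathcomp Require Import generic_quotient complex mxtens.
From mathcomp Require Import boolp reals trigo.

Set Implicit Arguments.
Unset Strict Implicit.
Unset Printing Implicit Defensive.

Import Order.TTheory GRing.Theory Num.Theory.
Local Open Scope ring_scope.
Local Open Scope quotient_scope.

(* Algebras given by generators and relations: noncommutative polynomial
   expressions over K in the generators X, modulo the least congruence that
   contains the relations and the axioms of associative unital K-algebras. *)

Inductive ncpoly (K X : Type) :=
| Gen of X
| Cst of K
| Add of ncpoly K X & ncpoly K X
| Mul of ncpoly K X & ncpoly K X.

Arguments Gen {K X}.
Arguments Cst {K X}.

HB.instance Definition _ (K X : Type) := gen_eqMixin (ncpoly K X).
HB.instance Definition _ (K X : Type) := gen_choiceMixin (ncpoly K X).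

Section Presented.
Variables (K : comNzRingType) (X : Type).
Variable rel : ncpoly K X -> ncpoly K X -> Prop.
Implicit Types t u v : ncpoly K X.

Inductive cong : ncpoly K X -> ncpoly K X -> Prop :=
| cong_rel t u : rel t u -> cong t u
| cong_refl t : cong t t
| cong_sym t u : cong t u -> cong u t
| cong_trans t u v : cong t u -> cong u v -> cong t v
| cong_add t t' u u' : cong t t' -> cong u u' -> cong (Add t u) (Add t' u')
| cong_mul t t' u u' : cong t t' -> cong u u' -> cong (Mul t u) (Mul t' u')
| cong_addA t u v : cong (Add t (Add u v)) (Add (Add t u) v)
| cong_addC t u : cong (Add t u) (Add u t)
| cong_add0 t : cong (Add (Cst 0) t) t
| cong_addN t : cong (Add (Mul (Cst (-1)) t) t) (Cst 0)
| cong_mulA t u v : cong (Mul t (Mul u v)) (Mul (Mul t u) v)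
| cong_mul1 t : cong (Mul (Cst 1) t) t
| cong_mulDl t u v : cong (Mul (Add t u) v) (Add (Mul t v) (Mul u v))
| cong_mulDr t u v : cong (Mul t (Add u v)) (Add (Mul t u) (Mul t v))
| cong_cstD a b : cong (Cst (a + b)) (Add (Cst a) (Cst b))
| cong_cstM a b : cong (Cst (a * b)) (Mul (Cst a) (Cst b))
| cong_cstC a t : cong (Mul (Cst a) t) (Mul t (Cst a)).

Definition congb t u : bool := `[< cong t u >].

Lemma congb_refl : reflexive congb.
Proof. by move=> t; apply/asboolP; apply: cong_refl. Qed.

Lemma congb_sym : symmetric congb.
Proof. by move=> t u; apply/asboolP/asboolP; apply: cong_sym. Qed.

Lemma congb_trans : transitive congb.
Proof.
by move=> u t v /asboolP tu /asboolP uv; apply/asboolP; apply: cong_trans uv.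
Qed.

Canonical congb_equiv := EquivRel congb congb_refl congb_sym congb_trans.

Definition presented := {eq_quot congb_equiv}.

HB.instance Definition _ := Choice.on presented.
HB.instance Definition _ := Quotient.on presented.

Implicit Types p q r : presented.

Definition pclass t : presented := \pi_presented t.

Lemma pclassP t u : cong t u -> pclass t = pclass u.
Proof. by move=> tu; apply/eqmodP/asboolP. Qed.

Lemma pclass_cong t u : pclass t = pclass u -> cong t u.
Proof. by move=> /eqmodP/asboolP. Qed.

Lemma pclass_repr p : pclass (repr p) = p.
Proof. exact: reprK. Qed.

Lemma cong_repr t : cong (repr (pclass t)) t.
Proof. by apply: pclass_cong; rewrite pclass_repr. Qed.

Lemma pclassW (Q : presented -> Prop) : (forall t, Q (pclass t)) -> forall p, Q p.
Proof. by move=> Qt p; rewrite -(pclass_repr p). Qed.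

Definition padd p q := pclass (Add (repr p) (repr q)).
Definition pmul p q := pclass (Mul (repr p) (repr q)).
Definition pcst a := pclass (Cst a).
Definition pgen x := pclass (Gen x).
Definition popp p := pmul (pcst (-1)) p.

Lemma paddE t u : padd (pclass t) (pclass u) = pclass (Add t u).
Proof. by apply: pclassP; apply: cong_add; apply: cong_repr. Qed.

Lemma pmulE t u : pmul (pclass t) (pclass u) = pclass (Mul t u).
Proof. by apply: pclassP; apply: cong_mul; apply: cong_repr. Qed.

Fact paddA : associative padd.
Proof.
elim/pclassW=> t; elim/pclassW=> u; elim/pclassW=> v.
by rewrite !paddE; apply/pclassP/cong_addA.
Qed.

Fact paddC : commutative padd.
Proof.
by elim/pclassW=> t; elim/pclassW=> u; rewrite !paddE; apply/pclassP/cong_addC.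
Qed.

Fact padd0 : left_id (pcst 0) padd.
Proof. by elim/pclassW=> t; rewrite paddE; apply/pclassP/cong_add0. Qed.

Fact paddN : left_inverse (pcst 0) popp padd.
Proof.
by elim/pclassW=> t; rewrite /popp pmulE paddE; apply/pclassP/cong_addN.
Qed.

Fact pmulA : associative pmul.
Proof.
elim/pclassW=> t; elim/pclassW=> u; elim/pclassW=> v.
by rewrite !pmulE; apply/pclassP/cong_mulA.
Qed.

Fact pmul1 : left_id (pcst 1) pmul.
Proof. by elim/pclassW=> t; rewrite pmulE; apply/pclassP/cong_mul1. Qed.

Fact pcst_comm a p : pmul (pcst a) p = pmul p (pcst a).
Proof. by elim/pclassW: p => t; rewrite !pmulE; apply/pclassP/cong_cstC. Qed.

Fact pmulr1 : right_id (pcst 1) pmul.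
Proof. by move=> p; rewrite -pcst_comm pmul1. Qed.

Fact pmulDl : left_distributive pmul padd.
Proof.
elim/pclassW=> t; elim/pclassW=> u; elim/pclassW=> v.
by rewrite !(pmulE, paddE); apply/pclassP/cong_mulDl.
Qed.

Fact pmulDr : right_distributive pmul padd.
Proof.
elim/pclassW=> t; elim/pclassW=> u; elim/pclassW=> v.
by rewrite !(pmulE, paddE); apply/pclassP/cong_mulDr.
Qed.

HB.instance Definition _ := GRing.isPzRing.Build presented
  paddA paddC padd0 paddN pmulA pmul1 pmulr1 pmulDl pmulDr.

Lemma pcstD : {morph pcst : a b / a + b}.
Proof. by move=> a b; rewrite /+%R /= paddE; apply/pclassP/cong_cstD. Qed.

Lemma pcstM : {morph pcst : a b / a * b}.
Proof. by move=> a b; rewrite /*%R /= pmulE; apply/pclassP/cong_cstM. Qed.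

HB.instance Definition _ :=
  GRing.isNmodMorphism.Build K presented pcst (conj (erefl _) pcstD).
HB.instance Definition _ :=
  GRing.isMonoidMorphism.Build K presented pcst (conj (erefl _) pcstM).

Fact pscaleA a b p : pcst a * (pcst b * p) = pcst (a * b) * p.
Proof. by rewrite mulrA pcstM. Qed.

Fact pscale1 p : pcst 1 * p = p.
Proof. exact: mul1r. Qed.

Fact pscaleDr a : {morph (fun p => pcst a * p) : p q / p + q}.
Proof. by move=> p q; rewrite mulrDr. Qed.

Fact pscaleDl p : {morph (fun a => pcst a * p) : a b / a + b}.
Proof. by move=> a b; rewrite pcstD mulrDl. Qed.

HB.instance Definition _ := GRing.Zmodule_isLmodule.Build K presented
  pscaleA pscale1 pscaleDr pscaleDl.

Lemma pscaleE a p : a *: p = pcst a * p. Proof. by []. Qed.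

Section Lift.
Variables (B : pzRingType) (c : {rmorphism K -> B}) (f : X -> B).

Fixpoint nceval t : B :=
  match t with
  | Gen x => f x
  | Cst a => c a
  | Add t u => nceval t + nceval u
  | Mul t u => nceval t * nceval u
  end.

(* The algebra morphism sending the generator x to f x, provided that f
   satisfies the relations (and that c is central). *)
Definition plift p : B := nceval (repr p).

Hypothesis c_central : forall a b, c a * b = b * c a.
Hypothesis f_rel : forall t u, rel t u -> nceval t = nceval u.

Lemma plift_class t : plift (pclass t) = nceval t.
Proof.
have cong_eval : forall u v, cong u v -> nceval u = nceval v.
  move=> u v; elim=> {u v} /=.
  - exact: f_rel.
  - by [].
  - by move=> u v _ ->.
  - by move=> u v w _ -> _ ->.
  - by move=> u u' v v' _ -> _ ->.
  - by move=> u u' v v' _ -> _ ->.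
  - by move=> u v w; rewrite addrA.
  - by move=> u v; rewrite addrC.
  - by move=> u; rewrite rmorph0 add0r.
  - by move=> u; rewrite rmorphN rmorph1 mulN1r addNr rmorph0.
  - by move=> u v w; rewrite mulrA.
  - by move=> u; rewrite rmorph1 mul1r.
  - by move=> u v w; rewrite mulrDl.
  - by move=> u v w; rewrite mulrDr.
  - by move=> a b; rewrite rmorphD.
  - by move=> a b; rewrite rmorphM.
  - by move=> a u; rewrite c_central.
by rewrite /plift; apply/cong_eval/cong_repr.
Qed.

Lemma plift_gen x : plift (pgen x) = f x. Proof. exact: plift_class. Qed.

Lemma plift_cst a : plift (pcst a) = c a. Proof. exact: plift_class. Qed.

Lemma pliftD : {morph plift : p q / p + q}.
Proof.
elim/pclassW=> t; elim/pclassW=> u.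
by rewrite [X in plift X]paddE !plift_class.
Qed.

Lemma pliftM : {morph plift : p q / p * q}.
Proof.
elim/pclassW=> t; elim/pclassW=> u.
by rewrite [X in plift X]pmulE !plift_class.
Qed.

Lemma plift1 : plift 1 = 1.
Proof. by rewrite [LHS]plift_cst rmorph1. Qed.

End Lift.
End Presented.

Arguments pgen {K X} rel x.
Arguments pcst {K X} rel a.

(* The tensor product of two algebras, generated by the pure tensors. *)
Section TensorAlgebra.
Variables (K : comNzRingType) (A B : algType K).

Inductive tens_rel : ncpoly K (A * B) -> ncpoly K (A * B) -> Prop :=
| tens_addl x x' y :
    tens_rel (Gen (x + x', y)) (Add (Gen (x, y)) (Gen (x', y)))
| tens_addr x y y' :
    tens_rel (Gen (x, y + y')) (Add (Gen (x, y)) (Gen (x, y')))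
| tens_scalel k x y : tens_rel (Gen (k *: x, y)) (Mul (Cst k) (Gen (x, y)))
| tens_scaler k x y : tens_rel (Gen (x, k *: y)) (Mul (Cst k) (Gen (x, y)))
| tens_mul x x' y y' :
    tens_rel (Gen (x * x', y * y')) (Mul (Gen (x, y)) (Gen (x', y')))
| tens_one : tens_rel (Gen (1, 1)) (Cst 1).

Definition talg := presented tens_rel.
HB.instance Definition _ := GRing.PzRing.on talg.
HB.instance Definition _ := GRing.Lmodule.on talg.

Definition ptens (x : A) (y : B) : talg := pgen tens_rel (x, y).

Local Ltac rel_class := by apply: pclassP; apply: cong_rel; constructor.

Lemma ptensDl x x' y : ptens (x + x') y = ptens x y + ptens x' y.
Proof. by rewrite [RHS]paddE; rel_class. Qed.
Lemma ptensDr x y y' : ptens x (y + y') = ptens x y + ptens x y'.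
Proof. by rewrite [RHS]paddE; rel_class. Qed.
Lemma ptensM x x' y y' : ptens x y * ptens x' y' = ptens (x * x') (y * y').
Proof. by rewrite [LHS]pmulE; apply/esym; rel_class. Qed.
Lemma ptens1 : ptens 1 1 = 1.
Proof. rel_class. Qed.
Lemma ptensZl k x y : ptens (k *: x) y = k *: ptens x y.
Proof. by rewrite [RHS]pmulE; rel_class. Qed.
Lemma ptensZr k x y : ptens x (k *: y) = k *: ptens x y.
Proof. by rewrite [RHS]pmulE; rel_class. Qed.

End TensorAlgebra.

(* Masuoka's algebra.  The sign in s_+, s_- is a boolean, true for +. *)

Inductive a4m_gen := gen_a | gen_s of bool.

Section A4m.
Variables (K : numFieldType) (m : nat).
Local Notation term := (ncpoly K a4m_gen).

Definition term_exp (t : term) n : term := iter n (Mul t) (Cst 1).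

Inductive a4m_rel : term -> term -> Prop :=
| a4m_central b : a4m_rel (Mul (Gen gen_a) (Gen (gen_s b)))
                          (Mul (Gen (gen_s b)) (Gen gen_a))
| a4m_asq : a4m_rel (Mul (Gen gen_a) (Gen gen_a)) (Cst 1)
| a4m_ssq b : a4m_rel (Mul (Gen (gen_s b)) (Gen (gen_s b))) (Cst 1)
| a4m_ssm :
    a4m_rel (term_exp (Mul (Gen (gen_s true)) (Gen (gen_s false))) m) (Cst 1).

Definition A4m := presented a4m_rel.
HB.instance Definition _ := GRing.PzRing.on A4m.
HB.instance Definition _ := GRing.Lmodule.on A4m.

Definition a4 : A4m := pgen a4m_rel gen_a.
Definition s4 (b : bool) : A4m := pgen a4m_rel (gen_s b).

Lemma nceval_exp (B : pzRingType) (c : {rmorphism K -> B}) f (t : term) n :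
  nceval c f (term_exp t n) = nceval c f t ^+ n.
Proof. by elim: n => [|n IHn] /=; rewrite ?rmorph1 // IHn exprS. Qed.

Definition a4m_fun (B : Type) (xa : B) (xs : bool -> B) (g : a4m_gen) : B :=
  match g with gen_a => xa | gen_s b => xs b end.

Lemma a4m_fun_rel (B : pzRingType) (c : {rmorphism K -> B}) xa xs :
  (forall b, xa * xs b = xs b * xa) -> xa * xa = 1 ->
  (forall b, xs b * xs b = 1) -> (xs true * xs false) ^+ m = 1 ->
  forall t u, a4m_rel t u ->
    nceval c (a4m_fun xa xs) t = nceval c (a4m_fun xa xs) u.
Proof.
by move=> ca aa ss sm t u [b||b|] /=; rewrite ?nceval_exp /= ?rmorph1.
Qed.

Definition a4m_counit : A4m -> K := plift (idfun : {rmorphism K -> K}) (fun=> 1).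

Lemma a4m_counit_rel t u : a4m_rel t u ->
  nceval (idfun : {rmorphism K -> K}) (fun=> 1) t =
  nceval (idfun : {rmorphism K -> K}) (fun=> 1) u.
Proof. by case=> [b||b|] /=; rewrite ?nceval_exp /= ?mulr1 ?expr1n. Qed.

Lemma a4m_one_neq0 : (1 : A4m) != 0.
Proof.
apply/eqP => /(congr1 a4m_counit).
rewrite /a4m_counit [LHS](plift_cst _ a4m_counit_rel) => [|? ?]; last exact: mulrC.
rewrite [RHS](plift_cst _ a4m_counit_rel) => [|? ?]; last exact: mulrC.
by move/eqP; rewrite oner_eq0.
Qed.

HB.instance Definition _ := GRing.PzSemiRing_isNonZero.Build A4m a4m_one_neq0.

Fact a4m_scaleAl k (x y : A4m) : k *: (x * y) = (k *: x) * y.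
Proof. exact: mulrA. Qed.
HB.instance Definition _ := GRing.Lmodule_isLalgebra.Build K A4m a4m_scaleAl.

Fact a4m_scaleAr k (x y : A4m) : k *: (x * y) = x * (k *: y).
Proof.
rewrite [LHS]mulrA [X in X * _](pcst_comm k x) -[LHS]mulrA; exact: erefl.
Qed.
HB.instance Definition _ := GRing.Lalgebra_isAlgebra.Build K A4m a4m_scaleAr.

Lemma a4C b : a4 * s4 b = s4 b * a4.
Proof. by rewrite [LHS]pmulE [RHS]pmulE; apply/pclassP/cong_rel; constructor. Qed.

Lemma a4_sq : a4 * a4 = 1.
Proof. by rewrite [LHS]pmulE; apply/pclassP/cong_rel; constructor. Qed.

Lemma s4_sq b : s4 b * s4 b = 1.
Proof. by rewrite [LHS]pmulE; apply/pclassP/cong_rel; constructor. Qed.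

Lemma pclass_exp t n : pclass a4m_rel (term_exp t n) = pclass a4m_rel t ^+ n.
Proof.
by elim: n => [|n IHn]; rewrite ?expr0 // exprS -IHn; apply/esym; apply: pmulE.
Qed.

Lemma s4_exp : (s4 true * s4 false) ^+ m = 1.
Proof.
rewrite [s4 true * _]pmulE -pclass_exp.
by apply/pclassP/cong_rel; constructor.
Qed.

Definition e4_0 : A4m := 2^-1 *: (1 + a4).
Definition e4_1 : A4m := 2^-1 *: (1 - a4).

Lemma half2 : 2^-1 + 2^-1 = 1 :> K.
Proof. by rewrite [RHS]splitr !mul1r. Qed.

Lemma e4_add : e4_0 + e4_1 = 1.
Proof. by rewrite -scalerDr addrACA subrr addr0 scalerDr -scalerDl half2 scale1r. Qed.

Lemma e4_01 : e4_0 * e4_1 = 0.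
Proof.
rewrite /e4_0 /e4_1 -scalerAl -scalerAr mulrDl mul1r mulrBr mulr1 a4_sq.
by rewrite addrA addrNK subrr !scaler0.
Qed.

Lemma e4_10 : e4_1 * e4_0 = 0.
Proof.
rewrite /e4_0 /e4_1 -scalerAl -scalerAr mulrDr mulr1 mulrBl mul1r a4_sq.
by rewrite addrA addrNK subrr !scaler0.
Qed.

Lemma e4_00 : e4_0 * e4_0 = e4_0.
Proof. by rewrite -[RHS]mulr1 -e4_add mulrDr e4_01 addr0. Qed.

Lemma e4_11 : e4_1 * e4_1 = e4_1.
Proof. by rewrite -[RHS]mulr1 -e4_add mulrDr e4_10 add0r. Qed.

Lemma e4_comm x : x * a4 = a4 * x ->
  x * e4_0 = e4_0 * x /\ x * e4_1 = e4_1 * x.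
Proof.
move=> xa; rewrite /e4_0 /e4_1 -!scalerAl -!scalerAr.
by rewrite mulrDl mulrBl mulrDr mulrBr !mulr1 !mul1r xa.
Qed.

(* Delta(a) = a (x) a and
   Delta(s_b) = s_b (x) e_0 s_b + s_(-b) (x) e_1 s_b. *)
Definition comul_gen : a4m_gen -> talg A4m A4m :=
  a4m_fun (ptens a4 a4)
    (fun b => ptens (s4 b) (e4_0 * s4 b) + ptens (s4 (~~ b)) (e4_1 * s4 b)).

Definition comul : A4m -> talg A4m A4m :=
  plift (pcst (@tens_rel K A4m A4m)) comul_gen.

Definition etens (x0 x1 y : A4m) : talg A4m A4m :=
  ptens x0 (e4_0 * y) + ptens x1 (e4_1 * y).

Lemma etens_diag x y : etens x x y = ptens x y.
Proof. by rewrite /etens -ptensDr -mulrDl e4_add mul1r. Qed.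

Lemma ptens0 x : ptens x 0 = 0 :> talg A4m A4m.
Proof. by apply: (addrI (ptens x 0)); rewrite -ptensDr !addr0. Qed.

Lemma etensM x0 x1 y x0' x1' y' : y * a4 = a4 * y ->
  etens x0 x1 y * etens x0' x1' y' = etens (x0 * x0') (x1 * x1') (y * y').
Proof.
move=> /e4_comm[ye0 ye1]; rewrite /etens mulrDl !mulrDr !ptensM.
have E e e' : y * e' = e' * y -> (e * y) * (e' * y') = (e * e') * (y * y').
  by move=> ye; rewrite !mulrA -(mulrA e) ye mulrA.
by rewrite !E // e4_00 e4_01 e4_10 e4_11 !mul0r !ptens0 addr0 add0r.
Qed.

Lemma etensX x0 x1 y n : y * a4 = a4 * y ->
  etens x0 x1 y ^+ n = etens (x0 ^+ n) (x1 ^+ n) (y ^+ n).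
Proof.
move=> ya; elim: n => [|n IHn]; first by rewrite !expr0 etens_diag ptens1.
by rewrite !exprS IHn etensM.
Qed.

Lemma s4_exp' : (s4 false * s4 true) ^+ m = 1.
Proof.
have E n : s4 false * (s4 true * s4 false) ^+ n =
           (s4 false * s4 true) ^+ n * s4 false.
  elim: n => [|n IHn]; first by rewrite !expr0 mulr1 mul1r.
  by rewrite exprSr mulrA IHn exprSr !mulrA.
by rewrite -[LHS]mulr1 -(s4_sq false) mulrA -E s4_exp mulr1 s4_sq.
Qed.

Lemma comul_rel t u : a4m_rel t u ->
  nceval (pcst (@tens_rel K A4m A4m)) comul_gen t =
  nceval (pcst (@tens_rel K A4m A4m)) comul_gen u.
Proof.
have sC b : s4 b * a4 = a4 * s4 b by rewrite a4C.
apply: a4m_fun_rel => [b||b|].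
- by rewrite -etens_diag -!/(etens _ _ _) !etensM // ?a4C // a4C a4C.
- by rewrite ptensM a4_sq ptens1.
- by rewrite -!/(etens _ _ _) etensM // !s4_sq etens_diag ptens1.
- rewrite -!/(etens _ _ _) etensM // etensX.
    by rewrite s4_exp s4_exp' etens_diag ptens1.
  by rewrite -mulrA sC mulrA sC mulrA.
Qed.

Lemma talg_central (a : K) (z : talg A4m A4m) :
  pcst (@tens_rel K A4m A4m) a * z = z * pcst (@tens_rel K A4m A4m) a.
Proof. exact: pcst_comm. Qed.

Lemma comulD x y : comul (x + y) = comul x + comul y.
Proof. exact: (pliftD talg_central comul_rel). Qed.
Lemma comulM x y : comul (x * y) = comul x * comul y.
Proof. exact: (pliftM talg_central comul_rel). Qed.
Lemma comul1 : comul 1 = 1.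
Proof. exact: (plift1 talg_central comul_rel). Qed.
Lemma comulZ k x : comul (k *: x) = k *: comul x.
Proof.
rewrite [LHS]comulM; congr (_ * _).
exact: (plift_cst talg_central comul_rel).
Qed.
Lemma comul_a : comul a4 = ptens a4 a4.
Proof. exact: (plift_gen talg_central comul_rel). Qed.
Lemma comul_s b : comul (s4 b) =
  ptens (s4 b) (e4_0 * s4 b) + ptens (s4 (~~ b)) (e4_1 * s4 b).
Proof. exact: (plift_gen talg_central comul_rel). Qed.

(* Finite-dimensional left modules, with carrier the column vectors K^n. *)
Record a4mod := A4Mod {
  mdim : nat;
  mact :> A4m -> 'M[K]_mdim;
  mact_linear : linear mact;
  mact_monoid : monoid_morphism mact
}.

Implicit Types (M N P : a4mod).

Section ModLift.
Variables (n : nat) (xa : 'M[K]_n) (xs : bool -> 'M[K]_n).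
Hypothesis xaC : forall b, xa *m xs b = xs b *m xa.
Hypothesis xa_sq : xa *m xa = 1%:M.
Hypothesis xs_sq : forall b, xs b *m xs b = 1%:M.
Hypothesis xs_exp : (xs true *m xs false) ^+ m = 1.

Let lift_act : A4m -> 'M[K]_n :=
  plift (@scalar_mx K n : {rmorphism K -> 'M[K]_n}) (a4m_fun xa xs).

Let lift_central (a : K) (x : 'M[K]_n) : a%:M * x = x * a%:M.
Proof. by apply: esym; exact: scalar_mxC. Qed.

Let lift_rel := a4m_fun_rel (@scalar_mx K n) xaC xa_sq xs_sq xs_exp.

Let lift_linear : linear lift_act.
Proof.
move=> k x y; rewrite [LHS](pliftD lift_central lift_rel).
congr (_ + _); rewrite [LHS](pliftM lift_central lift_rel).
by rewrite (plift_cst lift_central lift_rel) [LHS]mul_scalar_mx.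
Qed.

Let lift_monoid : monoid_morphism lift_act.
Proof.
split; first exact: (plift1 lift_central lift_rel).
exact: (pliftM lift_central lift_rel).
Qed.

Definition mod_of := A4Mod lift_linear lift_monoid.

Lemma mod_of_a : mod_of a4 = xa.
Proof. exact: (plift_gen lift_central lift_rel). Qed.

Lemma mod_of_s b : mod_of (s4 b) = xs b.
Proof. exact: (plift_gen lift_central lift_rel). Qed.

End ModLift.

(* The tensor product: K^n (x) K^p is identified with K^(n * p) through the
   Kronecker product, and x acts as Delta(x). *)
Section TensorModule.
Variables M N : a4mod.
Local Notation MN := 'M[K]_(mdim M * mdim N).

Definition tens_gen_act (xy : A4m * A4m) : MN := tensmx (M xy.1) (N xy.2).

Definition tens_act2 : talg A4m A4m -> MN :=
  plift (@scalar_mx K _ : {rmorphism K -> MN}) tens_gen_act.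

Lemma tens_act2_rel t u : tens_rel t u ->
  nceval (@scalar_mx K _ : {rmorphism K -> MN}) tens_gen_act t =
  nceval (@scalar_mx K _ : {rmorphism K -> MN}) tens_gen_act u.
Proof.
have MD := @mact_linear M; have ND := @mact_linear N.
have [M1 MM] := mact_monoid M; have [N1 NM] := mact_monoid N.
have lin0 (L : a4mod) : L 0 = 0.
  have := mact_linear L (-1) 0 0.
  by rewrite scaler0 addr0 scaleN1r addNr.
have linD (L : a4mod) x y : L (x + y) = L x + L y.
  by have := mact_linear L 1 x y; rewrite !scale1r.
have linZ (L : a4mod) k x : L (k *: x) = k *: L x.
  by have := mact_linear L k x 0; rewrite !addr0 lin0 addr0.
case=> [x x' y|x y y'|k x y|k x y|x x' y y'|] /=; rewrite /tens_gen_act /=.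
- by rewrite linD; apply/matrixP => i j; rewrite !mxE mulrDl.
- by rewrite linD; apply/matrixP => i j; rewrite !mxE mulrDr.
- rewrite linZ [RHS]mul_scalar_mx.
  by apply/matrixP => i j; rewrite !mxE mulrA.
- rewrite linZ [RHS]mul_scalar_mx.
  by apply/matrixP => i j; rewrite !mxE mulrCA.
- by rewrite MM NM [RHS]tensmx_mul.
- rewrite M1 N1; apply/matrixP => i j.
  case: (mxtens_indexP i) => i0 i1; case: (mxtens_indexP j) => j0 j1.
  rewrite tensmxE !mxE -natrM mulnb (can_eq (@mxtens_indexK _ _)).
  by rewrite xpair_eqE.
Qed.

Let smx_central (a : K) (x : MN) : a%:M * x = x * a%:M.
Proof. by apply: esym; exact: scalar_mxC. Qed.

Lemma tens_act2D z w : tens_act2 (z + w) = tens_act2 z + tens_act2 w.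
Proof. exact: (pliftD smx_central tens_act2_rel). Qed.
Lemma tens_act2M z w : tens_act2 (z * w) = tens_act2 z *m tens_act2 w.
Proof. exact: (pliftM smx_central tens_act2_rel). Qed.
Lemma tens_act2_1 : tens_act2 1 = 1%:M.
Proof. exact: (plift1 smx_central tens_act2_rel). Qed.
Lemma tens_act2Z k z : tens_act2 (k *: z) = k *: tens_act2 z.
Proof.
rewrite [LHS]tens_act2M -[RHS]mul_scalar_mx; congr (_ *m _).
exact: (plift_cst smx_central tens_act2_rel).
Qed.
Lemma tens_act2_pure x y : tens_act2 (ptens x y) = tensmx (M x) (N y).
Proof. exact: (plift_gen smx_central tens_act2_rel). Qed.

Definition tens_act (x : A4m) : MN := tens_act2 (comul x).

Fact tens_act_linear : linear tens_act.
Proof. by move=> k x y; rewrite /tens_act comulD comulZ tens_act2D tens_act2Z. Qed.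

Fact tens_act_monoid : monoid_morphism tens_act.
Proof.
by split=> [|x y]; rewrite /tens_act ?comul1 ?tens_act2_1 // comulM tens_act2M.
Qed.

Definition tens_mod := A4Mod tens_act_linear tens_act_monoid.

End TensorModule.

End A4m.

Arguments a4 {K m}.
Arguments s4 {K m} b.

Section GrothendieckRing.
Variables (K : numFieldType) (m : nat).
Local Notation A := (A4m K m).
Implicit Types M N P : a4mod K m.

Lemma counit_linear (k : K) (x y : A) :
  a4m_counit (k *: x + y) = k * a4m_counit x + a4m_counit y.
Proof.
have idC (a b : K) : idfun a * b = b * idfun a by exact: mulrC.
rewrite [LHS](pliftD idC (@a4m_counit_rel K m)); congr (_ + _).
rewrite [LHS](pliftM idC (@a4m_counit_rel K m)); congr (_ * _).
exact: (plift_cst idC (@a4m_counit_rel K m)).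
Qed.

Fact triv_linear : linear (fun x : A => (a4m_counit x)%:M : 'M[K]_1).
Proof. by move=> k x y; rewrite counit_linear raddfD /= scale_scalar_mx. Qed.

Fact triv_monoid : monoid_morphism (fun x : A => (a4m_counit x)%:M : 'M[K]_1).
Proof.
have idC (a b : K) : idfun a * b = b * idfun a by exact: mulrC.
split=> [|x y].
  by rewrite [a4m_counit _](plift1 idC (@a4m_counit_rel K m)).
rewrite [a4m_counit _](pliftM idC (@a4m_counit_rel K m)).
exact: scalar_mxM.
Qed.

Definition triv_mod : a4mod K m := A4Mod triv_linear triv_monoid.

Definition module_hom M N (f : 'M[K]_(mdim N, mdim M)) : Prop :=
  forall x : A, f *m M x = N x *m f.

Definition short_exact M' M M'' : Prop :=
  exists (f : 'M[K]_(mdim M, mdim M')) (g : 'M[K]_(mdim M'', mdim M)),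
  [/\ module_hom f, module_hom g,
      injective (fun w : 'cV[K]_(mdim M') => f *m w),
      (forall z : 'cV[K]_(mdim M''), exists w, z = g *m w) &
      (forall w : 'cV[K]_(mdim M), g *m w = 0 <-> exists w', w = f *m w')].

(* The Grothendieck ring: additive on short exact sequences, with the product
   of classes given by the tensor product.  As the tensor product is exact and
   is associative and unital up to isomorphism, the additive group of this
   ring is the usual Grothendieck group. *)
Inductive K0_rel : ncpoly int (a4mod K m) -> ncpoly int (a4mod K m) -> Prop :=
| K0_exact M' M M'' : short_exact M' M M'' ->
    K0_rel (Gen M) (Add (Gen M') (Gen M''))
| K0_tens M N : K0_rel (Mul (Gen M) (Gen N)) (Gen (tens_mod M N))
| K0_one : K0_rel (Cst 1) (Gen triv_mod).

Definition K0 := presented K0_rel.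
HB.instance Definition _ := GRing.PzRing.on K0.

Definition K0_class M : K0 := pgen K0_rel M.

Lemma K0_class_tens M N : K0_class M * K0_class N = K0_class (tens_mod M N).
Proof. by rewrite [LHS]pmulE; apply/pclassP/cong_rel; constructor. Qed.

Lemma K0_class_exact M' M M'' :
  short_exact M' M M'' -> K0_class M = K0_class M' + K0_class M''.
Proof. by move=> ?; rewrite [RHS]paddE; apply/pclassP/cong_rel; constructor. Qed.

End GrothendieckRing.

Section NamedModules.
Variable R : realType.
Local Notation C := R[i].

(* exp (2 pi sqrt(-1) / m) *)
Definition zeta (m : nat) : C :=
  Complex (cos (2 * pi / m%:R)) (sin (2 * pi / m%:R)).

Variable m : nat.
Implicit Types (L M N P Q : a4mod C m) (eps c : C) (i j : nat).

Definition vec M := 'cV[C]_(mdim M).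

Definition act M (x : A4m C m) (w : vec M) : vec M := M x *m w.

Definition tensv M N (w : vec M) (z : vec N) : vec (tens_mod M N) := tensmx w z.

Definition pi_formulas L eps i (u v : vec L) : Prop :=
  [/\ act (s4 true) u = v, act (s4 true) v = u,
      act (s4 false) u = zeta m ^+ i *: v,
      act (s4 false) v = zeta m ^- i *: u &
      act a4 u = eps *: u /\ act a4 v = eps *: v].

Definition T_formulas L (c1 c2 c3 : C) (t : vec L) : Prop :=
  [/\ act (s4 true) t = c1 *: t, act (s4 false) t = c2 *: t
    & act a4 t = c3 *: t].

(* L = pi_i^eps(u, v) *)
Definition is_pi L eps i (u v : vec L) : Prop :=
  basis_of fullv [:: u; v] /\ pi_formulas eps i u v.

(* L = T_{c1,c2,c3}(t) *)
Definition is_T L (c1 c2 c3 : C) (t : vec L) : Prop :=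
  basis_of fullv [:: t] /\ T_formulas c1 c2 c3 t.

(* L = pi_i^eps(u, v) (+) pi_i'^eps'(u', v'), as an internal direct sum *)
Definition is_pi_sum L eps i (u v : vec L) (eps' : C) (i' : nat) (u' v' : vec L) : Prop :=
  [/\ free [:: u; v] /\ pi_formulas eps i u v,
      free [:: u'; v'] /\ pi_formulas eps' i' u' v',
      (<<[:: u; v]>> + <<[:: u'; v']>> = fullv)%VS &
      directv (<<[:: u; v]>> + <<[:: u'; v']>>)].

(* The fusion rules: M (x) N decomposes on the displayed vectors, and the
   corresponding identity holds in the Grothendieck ring. *)

Definition fusion_pi_sum M N eps i (u v : vec (tens_mod M N))
    (eps' : C) (i' : nat) (u' v' : vec (tens_mod M N)) : Prop :=
  is_pi_sum eps i u v eps' i' u' v' /\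
  forall P (p q : vec P) Q (p' q' : vec Q),
    is_pi eps i p q -> is_pi eps' i' p' q' ->
    K0_class M * K0_class N = K0_class P + K0_class Q.

Definition fusion_pi M N eps i (u v : vec (tens_mod M N)) : Prop :=
  is_pi eps i u v /\
  forall P (p q : vec P), is_pi eps i p q ->
    K0_class M * K0_class N = K0_class P.

Definition fusion_T M N (c1 c2 c3 : C) (t : vec (tens_mod M N)) : Prop :=
  is_T c1 c2 c3 t /\
  forall P (p : vec P), is_T c1 c2 c3 p ->
    K0_class M * K0_class N = K0_class P.

Definition sign c : Prop := c = 1 \/ c = -1.

Lemma zetaX k : zeta m ^+ k =
  Complex (cos (2 * pi / m%:R *+ k)) (sin (2 * pi / m%:R *+ k)).
Proof.
elim: k => [|k IHk]; first by rewrite expr0 mulr0n cos0 sin0.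
rewrite exprS IHk [_ *+ k.+1]mulrS cosD sinD.
by apply/eqP; rewrite eq_complex /= eqxx addrC [X in X + _]mulrC eqxx.
Qed.

Lemma zeta_expm : (0 < m)%N -> zeta m ^+ m = 1.
Proof.
move=> m_gt0; rewrite zetaX -mulr_natr mulfVK ?pnatr_eq0 -?lt0n //.
by rewrite mulr_natl cos2pi sin2pi.
Qed.

Lemma sign_sq c : sign c -> c * c = 1.
Proof. by case=> ->; rewrite ?mulr1 // mulrNN mulr1. Qed.

Definition mx2 (x00 x01 x10 x11 : C) : 'M[C]_2 :=
  \matrix_(i, j) if i == 0 then if j == 0 then x00 else x01
                 else if j == 0 then x10 else x11.

Lemma mx2M x00 x01 x10 x11 y00 y01 y10 y11 :
  mx2 x00 x01 x10 x11 *m mx2 y00 y01 y10 y11 =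
  mx2 (x00 * y00 + x01 * y10) (x00 * y01 + x01 * y11)
      (x10 * y00 + x11 * y10) (x10 * y01 + x11 * y11).
Proof.
apply/matrixP => i j; rewrite !mxE !big_ord_recl big_ord0 !mxE /= addr0.
by case: ifP; case: ifP.
Qed.

Lemma mx2_scalar c : mx2 c 0 0 c = c%:M.
Proof.
apply/matrixP => i j; rewrite !mxE.
by case: i j => [[|[|[]]]] // ? [[|[|[]]]] //= ?; rewrite ?mulr1n ?mulr0n.
Qed.

Lemma mx2X x y k : mx2 x 0 0 y ^+ k = mx2 (x ^+ k) 0 0 (y ^+ k).
Proof.
elim: k => [|k IHk]; first by rewrite !expr0 mx2_scalar.
by rewrite !exprS IHk [LHS]mx2M !(mul0r, mulr0, addr0, add0r).
Qed.

Lemma mx2V x00 x01 x10 x11 (b : bool) :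
  mx2 x00 x01 x10 x11 *m delta_mx (if b then 1 else 0) 0 =
  (if b then x01 else x00) *: delta_mx 0 0 +
  (if b then x11 else x10) *: delta_mx 1 0 :> 'cV_2.
Proof.
apply/matrixP => i j; rewrite ord1 !mxE !big_ord_recl big_ord0 !mxE /= addr0.
by case: b; case: i => [[|[|[]]]] //= ?;
  rewrite ?(mulr0, mulr1, addr0, add0r).
Qed.

Lemma is_pi_exists eps i : (0 < m)%N -> sign eps ->
  exists L (u v : vec L), is_pi eps i u v.
Proof.
move=> m_gt0 /sign_sq eps_sq; have z1 := zeta_expm m_gt0.
set z := zeta m ^+ i.
have z_neq0 : z != 0.
  apply: expf_neq0; apply: contra_eq_neq z1 => ->.
  by rewrite expr0n gtn_eqF // eq_sym oner_eq0.
have zm : z ^+ m = 1 by rewrite -exprM mulnC exprM z1 expr1n.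
pose xs (b : bool) := if b then mx2 0 1 1 0 else mx2 0 z^-1 z 0.
have h1 b : eps%:M *m xs b = xs b *m eps%:M by rewrite scalar_mxC.
have h2 : eps%:M *m eps%:M = 1%:M :> 'M[C]_2 by rewrite -scalar_mxM eps_sq.
have h3 b : xs b *m xs b = 1%:M.
  by case: b; rewrite mx2M ?(mulr0, mul0r, addr0, add0r, mulr1) ?mulfV ?mulVf
    // mx2_scalar.
have h4 : (xs true *m xs false) ^+ m = 1.
  rewrite mx2M !(mulr0, mul0r, mul1r, addr0, add0r) mx2X exprVn zm invr1.
  exact: mx2_scalar.
pose L := mod_of h1 h2 h3 h4.
exists L, (delta_mx 0 0 : 'cV_2), (delta_mx 1 0 : 'cV_2); split.
  rewrite basisEfree subvf dimvf /= free_cons seq1_free span_seq1.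
  apply/andP; split; last by [].
  apply/andP; split.
    apply/vlineP => -[k /matrixP/(_ 0 0)].
    by rewrite !mxE /= mulr0 => /eqP; rewrite oner_eq0.
  by apply/eqP => /matrixP/(_ 1 0); rewrite !mxE /= => /eqP; rewrite oner_eq0.
have aE : L a4 = eps%:M by apply: mod_of_a.
have sE b : L (s4 b) = xs b by apply: mod_of_s.
have V0 x00 x01 x10 x11 := mx2V x00 x01 x10 x11 false.
have V1 x00 x01 x10 x11 := mx2V x00 x01 x10 x11 true.
split; rewrite /act ?sE ?aE.
- by rewrite [LHS]V0 scale0r scale1r add0r.
- by rewrite [LHS]V1 scale0r scale1r addr0.
- by rewrite [LHS]V0 scale0r add0r.
- by rewrite [LHS]V1 scale0r addr0.
- by split; rewrite [LHS]mul_scalar_mx.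
Qed.

Lemma is_T_exists c1 c2 c3 : ~~ odd m -> sign c1 -> sign c2 -> sign c3 ->
  exists L (t : vec L), is_T c1 c2 c3 t.
Proof.
move=> m_even /sign_sq s1 /sign_sq s2 /sign_sq s3.
pose xs (b : bool) : 'M[C]_1 := (if b then c1 else c2)%:M.
have h1 b : c3%:M *m xs b = xs b *m c3%:M by rewrite scalar_mxC.
have h2 : c3%:M *m c3%:M = 1%:M :> 'M[C]_1 by rewrite -scalar_mxM s3.
have h3 b : xs b *m xs b = 1%:M by case: b; rewrite -scalar_mxM ?s1 ?s2.
have h4 : (xs true *m xs false) ^+ m = 1.
  rewrite -scalar_mxM -rmorphXn /= -(odd_double_half m) (negbTE m_even) add0n.
  by rewrite -mul2n exprM expr2 mulrACA s1 s2 mulr1 expr1n.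
pose L := mod_of h1 h2 h3 h4.
exists L, (delta_mx 0 0 : 'cV_1); split.
  rewrite basisEfree subvf dimvf seq1_free andbT /=.
  by apply/eqP => /matrixP/(_ 0 0); rewrite !mxE /= => /eqP; rewrite oner_eq0.
have aE : L a4 = c3%:M by apply: mod_of_a.
have sE b : L (s4 b) = xs b by apply: mod_of_s.
by split; rewrite /act ?sE ?aE [LHS]mul_scalar_mx.
Qed.

End NamedModules.

Notation "w \ot z" := (tensv w z) (at level 40, left associativity).

(* Main.v *)
Require Import Defs.
From mathcomp Require Import all_boot all_order all_algebra.
From mathcomp Require Import complex reals.
From mathcomp Require Import mxtens trigo ring.

(** The fusion rules are explicit computations, once two points are settled.

    - The coproduct.  If [a4] acts by 1 on the second factor, both generators
      act diagonally on the tensor product ([s_b (x) s_b]); if it acts by -1,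
      then [s_b] acts as [s_(-b) (x) s_b] ([act_tens_s]).  Each of the displayed
      vectors can then be acted upon directly, and the formulas of a named
      two-dimensional module need to be checked on its first vector only
      ([pi_formulasI]).  The indices [m - i - j] and [m/2 - i] come from
      [lam ^+ m = 1] and [lam ^+ (m/2) = -1].  That the displayed vectors form
      a basis is the statement that tensors of two bases form a basis
      ([basis_tensmx]).

    - The Grothendieck ring.  Two modules with bases on which the generators act
      by the same formulas are isomorphic: the linear map that matches the bases
      commutes with the generators, hence with the whole algebra
      ([module_hom_gen]).  Matching the bases of P and Q with the two halves of
      a basis of L in the same way gives [K0_class L = K0_class P + K0_class Q]
      through the split exact sequence from P to L to Q ([K0_class_split]). *)

Set Implicit Arguments.
Unset Strict Implicit.
Unset Printing Implicit Defensive.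

Import Order.TTheory GRing.Theory Num.Theory.
Local Open Scope ring_scope.

(** * Matrices and bases of column vectors *)

Section ColumnBases.
Variable K : fieldType.

(** Matrices defined by the images of basis vectors: this turns the formulas
    for a named module into intertwiners between concrete modules. *)
Lemma mulmx_extend n p (X : seq 'cV[K]_n) (Y : seq 'cV[K]_p) :
  free X -> size Y = size X -> exists F : 'M_(p, n), map (mulmx F) X = Y.
Proof.
move=> freeX sYX; pose T := in_tuple X.
pose F : 'M[K]_(p, n) :=
  \matrix_(i, j) (\sum_(l < size X) coord T l (delta_mx j 0) *: Y`_l) i 0.
have FE w : F *m w = \sum_(l < size X) coord T l w *: Y`_l.
  rewrite [in RHS](matrix_sum_delta w).
  apply/colP => i; rewrite !mxE summxE.
  under [RHS]eq_bigr => l _.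
    rewrite linear_sum mxE mulr_suml; under eq_bigr => j _.
      rewrite big_ord1 linearZ /= -mulrA; over.
    over.
  rewrite exchange_big /=; apply: eq_bigr => j _.
  rewrite mxE summxE mulr_suml; apply: eq_bigr => l _.
  by rewrite mxE mulrC.
exists F; apply: (@eq_from_nth _ 0); rewrite size_map // => l lX.
rewrite (nth_map 0) // FE (bigD1 (Ordinal lX)) //= big1 ?addr0.
  by rewrite (coord_free (X := T) (Ordinal lX) (Ordinal lX) freeX) eqxx scale1r.
move=> k kl; rewrite (coord_free (X := T) (Ordinal lX) k freeX).
by rewrite eq_sym (negbTE kl) scale0r.
Qed.

Lemma eq_mulmx_basis n p (X : seq 'cV[K]_n) (F G : 'M_(p, n)) :
  basis_of fullv X -> (forall w, w \in X -> F *m w = G *m w) -> F = G.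
Proof.
move=> /span_basis spX FG.
have {}FG (w : 'cV_n) : F *m w = G *m w.
  have: w \in <<X>>%VS by rewrite spX memvf.
  move/(coord_span (X := in_tuple X))=> ->; rewrite !mulmx_sumr.
  by apply: eq_bigr => i _; rewrite -!scalemxAr FG // mem_nth.
by apply/matrixP => i j; have /colP/(_ i) := FG (delta_mx j 0);
  rewrite -!colE !mxE.
Qed.

Local Notation tensc w z := (tensmx (w : 'cV_(_)) (z : 'cV_(_)) : 'cV_(_ * _)).

Lemma tenscDl n p (w w' : 'cV[K]_n) (z : 'cV[K]_p) :
  tensc (w + w') z = tensc w z + tensc w' z.
Proof. by apply/matrixP => i j; rewrite !mxE mulrDl. Qed.

Lemma tenscDr n p (w : 'cV[K]_n) (z z' : 'cV[K]_p) :
  tensc w (z + z') = tensc w z + tensc w z'.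
Proof. by apply/matrixP => i j; rewrite !mxE mulrDr. Qed.

Lemma tenscZl n p c (w : 'cV[K]_n) (z : 'cV[K]_p) :
  tensc (c *: w) z = c *: tensc w z.
Proof. by apply/matrixP => i j; rewrite !mxE mulrA. Qed.

Lemma tenscZr n p c (w : 'cV[K]_n) (z : 'cV[K]_p) :
  tensc w (c *: z) = c *: tensc w z.
Proof. by apply/matrixP => i j; rewrite !mxE mulrCA. Qed.

Lemma tensc_delta n p (i : 'I_n) (j : 'I_p) :
  tensc (delta_mx i 0) (delta_mx j 0) =
  delta_mx (mxtens_index (i, j)) 0 :> 'cV[K]_(n * p).
Proof.
apply/colP => k; case: (mxtens_indexP k) => k1 k2.
have -> : (0 : 'I_1) = mxtens_index (0 : 'I_1, 0 : 'I_1) by rewrite [RHS]ord1.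
rewrite [LHS]tensmxE !mxE !eqxx !andbT -natrM mulnb.
by rewrite (can_eq (@mxtens_indexK _ _)) xpair_eqE.
Qed.

(** Pure tensors of the standard basis vectors span, so tensors of two spanning
    families span; the dimension count makes them a basis. *)
Lemma basis_tensmx n p (X : seq 'cV[K]_n) (Y : seq 'cV[K]_p) :
  basis_of fullv X -> basis_of fullv Y ->
  basis_of (fullv : {vspace 'cV[K]_(n * p)})
    [seq tensc x y | x <- X, y <- Y].
Proof.
move=> bX bY; rewrite basisEdim size_allpairs.
rewrite -(size_basis (X := in_tuple X) bX) -(size_basis (X := in_tuple Y) bY).
rewrite !dimvf /dim /= !muln1 leqnn andbT; apply/subvP => z _.
set V := <<_>>%VS.
have tV (w : 'cV_n) (w' : 'cV_p) : tensc w w' \in V.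
  have: w \in <<X>>%VS by rewrite (span_basis bX) memvf.
  have: w' \in <<Y>>%VS by rewrite (span_basis bY) memvf.
  move=> /(coord_span (X := in_tuple Y))-> /(coord_span (X := in_tuple X))->.
  elim/big_rec: _ => [|i u _ uV]; first by rewrite tens0mx mem0v.
  rewrite tenscDl rpredD // tenscZl rpredZ //.
  elim/big_rec: _ => [|j v _ vV]; first by rewrite tensmx0 mem0v.
  rewrite tenscDr rpredD // tenscZr rpredZ // memv_span //.
  by apply: allpairs_f; apply: mem_nth.
rewrite (matrix_sum_delta z); apply: rpred_sum => k _.
apply: rpred_sum => j _; rewrite ord1 rpredZ //.
by case: (mxtens_indexP k) => k1 k2; rewrite -tensc_delta.
Qed.

Lemma basis_scale (vT : vectType K) (U : {vspace vT}) c (x : vT) X :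
  c != 0 -> basis_of U (x :: X) -> basis_of U (c *: x :: X).
Proof.
move=> c0; rewrite !basisEdim /= => /andP[UX ->]; rewrite andbT.
apply: subv_trans UX _; rewrite !span_cons; apply: addvS => //.
by rewrite -memvE -[X in X \in _](scalerK c0) rpredZ // memv_line.
Qed.

Lemma basis_swap (vT : vectType K) (U : {vspace vT}) (x y : vT) :
  basis_of U [:: x; y] -> basis_of U [:: y; x].
Proof. by rewrite (perm_basis _ (permEl (perm_catC [:: x] [:: y]))). Qed.

Lemma basis_perm (vT : vectType K) (U : {vspace vT}) (X Y : seq vT) :
  basis_of U X -> perm_eq X Y -> basis_of U Y.
Proof. by move=> bX /perm_basis <-. Qed.

End ColumnBases.

(** * Intertwiners and the Grothendieck ring *)

Section Intertwiners.
Variables (K : numFieldType) (m : nat).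
Implicit Types L M N P Q : a4mod K m.

Lemma mactZ M k x : M (k *: x) = k *: M x.
Proof.
have M0 : M 0 = 0.
  by have := mact_linear M (-1) 0 0; rewrite scaler0 addr0 scaleN1r addNr.
by have := mact_linear M k x 0; rewrite !addr0 M0 addr0.
Qed.

Lemma mactD M x y : M (x + y) = M x + M y.
Proof. by have := mact_linear M 1 x y; rewrite !scale1r. Qed.

Lemma mactM M x y : M (x * y) = M x *m M y.
Proof. by have [_] := mact_monoid M; apply. Qed.

Lemma mact1 M : M 1 = 1%:M.
Proof. by have [] := mact_monoid M. Qed.

(** The elements that commute with a given map form a subalgebra. *)
Lemma module_hom_gen M N (F : 'M_(mdim N, mdim M)) :
  F *m M a4 = N a4 *m F -> (forall b, F *m M (s4 b) = N (s4 b) *m F) ->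
  module_hom F.
Proof.
move=> Fa Fs; elim/pclassW; elim=> [[|b]|c|t IHt u IHu|t IHt u IHu].
- exact: Fa.
- exact: Fs.
- have -> : pclass (@a4m_rel K m) (Cst c) = c *: 1 :> A4m K m.
    by rewrite pscaleE mulr1.
  by rewrite !mactZ !mact1 -scalemxAr -scalemxAl mulmx1 mul1mx.
- have -> : pclass (@a4m_rel K m) (Add t u) =
    pclass (@a4m_rel K m) t + pclass (@a4m_rel K m) u :> A4m K m.
    by rewrite [RHS]paddE.
  by rewrite !mactD mulmxDr mulmxDl IHt IHu.
- have -> : pclass (@a4m_rel K m) (Mul t u) =
    (pclass (@a4m_rel K m) t : A4m K m) * pclass (@a4m_rel K m) u.
    by rewrite [RHS]pmulE.
  by rewrite !mactM mulmxA IHt -!mulmxA IHu.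
Qed.

Lemma module_hom_basis M N (F : 'M_(mdim N, mdim M)) (X : seq 'cV_(mdim M)) :
  basis_of fullv X ->
  (forall w, w \in X -> F *m (M a4 *m w) = N a4 *m (F *m w)) ->
  (forall b w, w \in X -> F *m (M (s4 b) *m w) = N (s4 b) *m (F *m w)) ->
  module_hom F.
Proof.
move=> bX Fa Fs.
by apply: module_hom_gen => [|b]; apply: eq_mulmx_basis bX _ => w wX;
  rewrite -!mulmxA ?Fa ?Fs.
Qed.

(** P -> L -> Q, through F and J, is exact because F, G are the injections and
    H, J the projections of a direct sum; J inherits the compatibility with the
    action from the injections. *)
Lemma K0_class_split L P Q (F : 'M_(mdim L, mdim P)) (G : 'M_(mdim L, mdim Q))
    (H : 'M_(mdim P, mdim L)) (J : 'M_(mdim Q, mdim L)) :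
  module_hom F -> module_hom G -> H *m F = 1%:M -> J *m G = 1%:M ->
  F *m H + G *m J = 1%:M -> K0_class L = K0_class P + K0_class Q.
Proof.
move=> homF homG HF JG FHGJ.
have JF : J *m F = 0.
  have JFH : J *m F *m H = 0.
    apply: (addIr J); rewrite add0r -[X in _ + X]mul1mx -JG -!mulmxA -mulmxDr.
    by rewrite FHGJ mulmx1.
  by rewrite -[J *m F]mulmx1 -HF mulmxA JFH mul0mx.
apply: K0_class_exact; exists F, J; split=> //.
- move=> x; rewrite -[LHS]mulmx1 -FHGJ mulmxDr mulmxA -[J *m _ *m F]mulmxA.
  rewrite -homF mulmxA JF !mul0mx add0r !mulmxA -[J *m _ *m G]mulmxA -homG.
  by rewrite mulmxA JG mul1mx.
- by move=> w w' /(congr1 (mulmx H)); rewrite !mulmxA HF !mul1mx.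
- by move=> z; exists (G *m z); rewrite mulmxA JG mul1mx.
- move=> w; split=> [Jw|[w' ->]]; last by rewrite mulmxA JF mul0mx.
  exists (H *m w).
  by rewrite -[LHS]mul1mx -FHGJ mulmxDl -!mulmxA Jw mulmx0 addr0.
Qed.

(** Isomorphic modules have the same class: split off the zero module, whose
    class is idempotent for addition and hence zero. *)
Lemma K0_class_iso L P (F : 'M_(mdim L, mdim P)) (H : 'M_(mdim P, mdim L)) :
  module_hom F -> H *m F = 1%:M -> F *m H = 1%:M -> K0_class L = K0_class P.
Proof.
move=> homF HF FH.
have eq0 (x y : 'M[K]_0) : x = y by rewrite [x]flatmx0 [y]flatmx0.
pose Z : a4mod K m := @mod_of K m 0 0 (fun=> 0) (fun=> eq0 _ _) (eq0 _ _)
  (fun=> eq0 _ _) (eq0 _ _).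
have homZ M (G : 'M_(mdim M, mdim Z)) : module_hom G.
  by move=> x; rewrite [LHS]thinmx0 [RHS]thinmx0.
have Z0 : K0_class Z = 0.
  apply: (addIr (K0_class Z)); rewrite add0r.
  by apply/esym/(@K0_class_split Z Z Z 0 0 0 0) => //; apply: eq0.
rewrite (@K0_class_split L P Z F 0 H 0) ?Z0 ?addr0 ?mul0mx ?addr0 //.
Qed.

End Intertwiners.

(** * The named modules *)

Section Named.
Variables (R : realType) (m : nat).
Local Notation C := R[i].
Local Notation lam := (zeta R m).
Implicit Types (L M N P Q : a4mod C m) (eps c : C) (i j : nat).

Lemma act_sK M b (w : vec M) : act (s4 b) (act (s4 b) w) = w.
Proof. by rewrite /act mulmxA -mactM s4_sq mact1 mul1mx. Qed.

Lemma act_saC M b (w : vec M) : act a4 (act (s4 b) w) = act (s4 b) (act a4 w).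
Proof. by rewrite /act !mulmxA -!mactM a4C. Qed.

Lemma actZ M x c (w : vec M) : act x (c *: w) = c *: act x w.
Proof. by rewrite /act -scalemxAr. Qed.

Lemma zeta_neq0 k : (0 < m)%N -> lam ^+ k != 0.
Proof.
move=> m_gt0; apply: expf_neq0; apply: contra_eq_neq (zeta_expm R m_gt0) => ->.
by rewrite expr0n gtn_eqF // eq_sym oner_eq0.
Qed.

Lemma zeta_half : (0 < m)%N -> ~~ odd m -> lam ^+ m./2 = -1.
Proof.
move=> m_gt0 m_even; have mE : m = (m./2 * 2)%N.
  by rewrite muln2 -[LHS]odd_double_half (negbTE m_even).
have h_neq0 : m./2%:R != 0 :> R.
  by rewrite pnatr_eq0; apply: contraTneq m_gt0 => h0; rewrite mE h0.
have -> : lam ^+ m./2 = Complex (cos (pi : R)) (sin (pi : R)).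
  rewrite zetaX -mulr_natr [in X in _ / X]mE natrM.
  by rewrite (_ : 2 * pi / _ * _ = pi) //; field.
by rewrite cospi sinpi; apply/eqP; rewrite eq_complex /= oppr0 !eqxx.
Qed.

(** The remaining equations of the two-dimensional module follow because
    [s4 true] and [s4 false] are involutions and [a4] is central. *)
Lemma pi_formulasI L eps i (u v : vec L) : (0 < m)%N ->
  act (s4 true) u = v -> act (s4 false) u = lam ^+ i *: v ->
  act a4 u = eps *: u -> pi_formulas eps i u v.
Proof.
move=> m_gt0 su s'u au; split=> //.
- by rewrite -su act_sK.
- rewrite -[in RHS](act_sK false u) s'u actZ scalerA.
  by rewrite mulVf ?scale1r ?zeta_neq0.
- by split; rewrite // -su act_saC au actZ.
Qed.

Lemma pi_hom L P eps i (p q : vec P) (u v : vec L)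
    (F : 'M_(mdim L, mdim P)) :
  is_pi eps i p q -> pi_formulas eps i u v -> F *m p = u -> F *m q = v ->
  module_hom F.
Proof.
move=> [bP [sp sq s'p s'q [ap aq]]] [su sv s'u s'v [au av]] Fp Fq.
rewrite /act in sp sq s'p s'q ap aq.
apply: module_hom_basis bP _ _ => [w|b w].
  by rewrite !inE => /orP[]/eqP->; rewrite ?ap ?aq -!scalemxAr ?Fp ?Fq
    ?[RHS]au ?[RHS]av.
by rewrite !inE; case: b => /orP[]/eqP->;
  rewrite ?sp ?sq ?s'p ?s'q -?scalemxAr ?Fp ?Fq;
  rewrite ?[RHS]su ?[RHS]sv ?[RHS]s'u ?[RHS]s'v.
Qed.

Lemma T_hom L P c1 c2 c3 (p : vec P) (t : vec L) (F : 'M_(mdim L, mdim P)) :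
  is_T c1 c2 c3 p -> T_formulas c1 c2 c3 t -> F *m p = t -> module_hom F.
Proof.
move=> [bP [sp s'p ap]] [st s't at_] Fp; rewrite /act in sp s'p ap.
apply: module_hom_basis bP _ _ => [w|b w].
  by rewrite !inE => /eqP->; rewrite ap -!scalemxAr Fp [RHS]at_.
by rewrite !inE; case: b => /eqP->; rewrite ?sp ?s'p -?scalemxAr Fp
  ?[RHS]st ?[RHS]s't.
Qed.

Lemma K0_class_pi L P eps i (p q : vec P) (u v : vec L) :
  is_pi eps i u v -> is_pi eps i p q -> K0_class L = K0_class P.
Proof.
move=> [bL fL] [bP fP].
have [F [Fp Fq]] := mulmx_extend (basis_free bP) (erefl : size [:: u; v] = 2).
have [H [Hu Hv]] := mulmx_extend (basis_free bL) (erefl : size [:: p; q] = 2).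
apply: (@K0_class_iso _ _ L P F H); first exact: pi_hom (conj bP fP) fL Fp Fq.
- apply: eq_mulmx_basis bP _ => w; rewrite !inE mul1mx -mulmxA.
  by case/orP=> /eqP->; rewrite ?Fp ?Fq.
- apply: eq_mulmx_basis bL _ => w; rewrite !inE mul1mx -mulmxA.
  by case/orP=> /eqP->; rewrite ?Hu ?Hv.
Qed.

Lemma K0_class_T L P c1 c2 c3 (p : vec P) (t : vec L) :
  is_T c1 c2 c3 t -> is_T c1 c2 c3 p -> K0_class L = K0_class P.
Proof.
move=> [bL fL] [bP fP].
have [F [Fp]] := mulmx_extend (basis_free bP) (erefl : size [:: t] = 1%N).
have [H [Ht]] := mulmx_extend (basis_free bL) (erefl : size [:: p] = 1%N).
apply: (@K0_class_iso _ _ L P F H); first exact: T_hom (conj bP fP) fL Fp.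
- by apply: eq_mulmx_basis bP _ => w; rewrite !inE mul1mx -mulmxA => /eqP->;
    rewrite Fp.
- by apply: eq_mulmx_basis bL _ => w; rewrite !inE mul1mx -mulmxA => /eqP->;
    rewrite Ht.
Qed.

Lemma K0_class_pi_sum L P Q eps i (u v : vec L) eps' i' (u' v' : vec L)
    (p q : vec P) (p' q' : vec Q) :
  basis_of fullv [:: u; v; u'; v'] ->
  pi_formulas eps i u v -> pi_formulas eps' i' u' v' ->
  is_pi eps i p q -> is_pi eps' i' p' q' ->
  K0_class L = K0_class P + K0_class Q.
Proof.
move=> bL fL fL' [bP fP] [bQ fQ].
have [F [Fp Fq]] := mulmx_extend (basis_free bP) (erefl : size [:: u; v] = 2).
have [G [Gp Gq]] := mulmx_extend (basis_free bQ) (erefl : size [:: u'; v'] = 2).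
have [H [Hu Hv Hu' Hv']] :=
  mulmx_extend (basis_free bL) (erefl : size [:: p; q; 0; 0] = 4).
have [J [Ju Jv Ju' Jv']] :=
  mulmx_extend (basis_free bL) (erefl : size [:: 0; 0; p'; q'] = 4).
apply: (@K0_class_split _ _ L P Q F G H J).
- exact: pi_hom (conj bP fP) fL Fp Fq.
- exact: pi_hom (conj bQ fQ) fL' Gp Gq.
- apply: eq_mulmx_basis bP _ => w; rewrite !inE mul1mx -mulmxA.
  by case/orP=> /eqP->; rewrite ?Fp ?Fq.
- apply: eq_mulmx_basis bQ _ => w; rewrite !inE mul1mx -mulmxA.
  by case/orP=> /eqP->; rewrite ?Gp ?Gq.
- apply: eq_mulmx_basis bL _ => w; rewrite !inE mul1mx mulmxDl -!mulmxA.
  by case/or4P=> /eqP->; rewrite ?(Hu, Hv, Hu', Hv', Ju, Jv, Ju', Jv')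
    ?mulmx0 ?addr0 ?add0r.
Qed.

(** * Tensor products of named modules *)

Lemma mulmx_tensv M N A B (w : vec M) (z : vec N) :
  tensmx A B *m (w \ot z) = (A *m w : vec M) \ot (B *m z : vec N).
Proof. exact: (@tensmx_mul C _ _ _ _ 1 1 A B w z). Qed.

Lemma act_tens_a M N (w : vec M) (z : vec N) :
  act a4 (w \ot z) = act a4 w \ot act a4 z.
Proof. by rewrite /act /= /tens_act comul_a tens_act2_pure mulmx_tensv. Qed.

(** The idempotents of the coproduct select its first or second summand
    according to the eigenvalue of [a4] on the second factor; the second summand
    exchanges [s4 true] and [s4 false] on the first factor. *)
Lemma act_tens_s M N b (d : bool) (w : vec M) (z : vec N) :
  act a4 z = (-1) ^+ d *: z ->
  act (s4 b) (w \ot z) = act (s4 (b (+) d)) w \ot act (s4 b) z.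
Proof.
move=> az; set sz := act (s4 b) z.
have asz : N a4 *m sz = (-1) ^+ d *: sz.
  by rewrite [LHS]act_saC az actZ.
have e0 : N (e4_0 C m * s4 b) *m z = (~~ d)%:R *: sz.
  rewrite mactM -mulmxA -/(act _ z) -/sz mactZ mactD mact1 -scalemxAl mulmxDl.
  rewrite mul1mx asz; case: (d); rewrite /= ?expr1 ?expr0.
    by rewrite scaleN1r subrr scaler0 scale0r.
  rewrite !scale1r -mulr2n -(scaler_nat 2 sz) scalerA.
  by rewrite mulVf ?scale1r ?pnatr_eq0.
have e1 : N (e4_1 C m * s4 b) *m z = d%:R *: sz.
  have -> : e4_1 C m = 1 - e4_0 C m by rewrite -(e4_add C m) addrC addKr.
  rewrite mulrDl mul1r mulNr mactD mulmxDl -scaleN1r mactZ -scalemxAl e0.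
  rewrite -/(act _ z) -/sz scalerA mulN1r -[X in X + _]scale1r -scalerDl.
  by case: (d); rewrite ?subr0 ?subrr.
rewrite /act /= /tens_act comul_s tens_act2D !tens_act2_pure mulmxDl.
rewrite !mulmx_tensv e0 e1; case: (d); rewrite ?addbT ?addbF /=.
  by rewrite scale0r /tensv tensmx0 add0r scale1r.
by rewrite scale0r /tensv tensmx0 addr0 scale1r.
Qed.

Lemma tensvZl M N c (w : vec M) (z : vec N) : (c *: w) \ot z = c *: (w \ot z).
Proof. exact: tenscZl. Qed.

Lemma tensvZr M N c (w : vec M) (z : vec N) : w \ot (c *: z) = c *: (w \ot z).
Proof. exact: tenscZr. Qed.

Lemma fusion_piI M N eps i (u v : vec (tens_mod M N)) :
  basis_of fullv [:: u; v] -> pi_formulas eps i u v -> fusion_pi eps i u v.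
Proof.
move=> bL fL; have piL : is_pi eps i u v by split.
by split=> // P p q piP; rewrite K0_class_tens; apply: K0_class_pi piL piP.
Qed.

Lemma fusion_TI M N c1 c2 c3 (t : vec (tens_mod M N)) :
  basis_of fullv [:: t] -> T_formulas c1 c2 c3 t -> fusion_T c1 c2 c3 t.
Proof.
move=> bL fL; have TL : is_T c1 c2 c3 t by split.
by split=> // P p TP; rewrite K0_class_tens; apply: K0_class_T TL TP.
Qed.

Lemma fusion_pi_sumI M N eps i (u v : vec (tens_mod M N))
    eps' i' (u' v' : vec (tens_mod M N)) :
  basis_of fullv [:: u; v; u'; v'] ->
  pi_formulas eps i u v -> pi_formulas eps' i' u' v' ->
  fusion_pi_sum eps i u v eps' i' u' v'.
Proof.
move=> bL fL fL'; split=> [|P p q Q p' q' piP piQ].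
  have /basis_free := bL; rewrite -[X in free X]/([:: u; v] ++ [:: u'; v']).
  rewrite cat_free => /and3P[? ? ?]; split=> //.
  by rewrite -span_cat; apply: span_basis bL.
by rewrite K0_class_tens; apply: K0_class_pi_sum fL fL' piP piQ.
Qed.

Lemma zetaB i j :
  (0 < m)%N -> (j <= i)%N -> lam ^+ (i - j) = lam ^+ i * lam ^- j.
Proof.
move=> m_gt0 le_ji; apply: exprB => //.
by rewrite unitfE -[X in X != 0]expr1 zeta_neq0.
Qed.

Hypothesis m_gt0 : (0 < m)%N.

(** The span of [u \ot y] and [v \ot x] is the i - j constituent, and that of
    [u \ot x] and [v \ot y] the i + j one; naming either by the opposite index
    amounts to exchanging its two basis vectors. *)
Lemma pi_tens_pi1 i j eps M N (u v : vec M) (x y : vec N) :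
  is_pi eps i u v -> is_pi 1 j x y ->
  [/\ (i + j <= m)%N -> pi_formulas eps (m - i - j) (v \ot y) (u \ot x),
      pi_formulas eps (i + j) (u \ot x) (v \ot y),
      (j <= i)%N -> pi_formulas eps (i - j) (u \ot y) (v \ot x) &
      (i <= j)%N -> pi_formulas eps (j - i) (v \ot x) (u \ot y)].
Proof.
move=> [_ [su sv s'u s'v [au av]]] [_ [sx sy s'x s'y [ax ay]]].
have tx b w := act_tens_s b (d := false) w ax.
have ty b w := act_tens_s b (d := false) w ay.
split=> [le_ijm||le_ji|le_ij]; apply: pi_formulasI => //;
  rewrite ?(tx, ty) ?act_tens_a /= ?addbF
    ?(su, sv, s'u, s'v, sx, sy, s'x, s'y, au, av, ax, ay)
    ?tensvZl ?tensvZr ?scalerA ?mulr1 ?mul1r //; congr (_ *: _).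
- by rewrite -subnDA zetaB // zeta_expm // mul1r exprD invfM.
- by rewrite exprD.
- by rewrite zetaB.
- by rewrite zetaB // mulrC.
Qed.

(** Here [s4 true] acts on the first factor as [s4 false]; the coefficient
    [lam ^+ i] makes it exchange the two displayed vectors. *)
Lemma pi_tens_piN1 i j eps M N (u v : vec M) (x y : vec N) :
  is_pi eps i u v -> is_pi (-1) j x y ->
  [/\ (i + j <= m)%N ->
        pi_formulas (- eps) (m - i - j) (u \ot y) (lam ^+ i *: (v \ot x)),
      pi_formulas (- eps) (i + j) (lam ^+ i *: (v \ot x)) (u \ot y),
      (j <= i)%N ->
        pi_formulas (- eps) (i - j) (lam ^+ i *: (v \ot y)) (u \ot x) &
      (i <= j)%N ->
        pi_formulas (- eps) (j - i) (u \ot x) (lam ^+ i *: (v \ot y))].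
Proof.
move=> [_ [su sv s'u s'v [au av]]] [_ [sx sy s'x s'y [ax ay]]].
have tx b w := act_tens_s b (d := true) w ax.
have ty b w := act_tens_s b (d := true) w ay.
have li := mulfV (zeta_neq0 i m_gt0).
have li' := mulVf (zeta_neq0 i m_gt0).
have lj := mulfV (zeta_neq0 j m_gt0).
split=> [le_ijm||le_ji|le_ij]; apply: pi_formulasI => //;
  rewrite ?actZ ?(tx, ty) ?act_tens_a /= ?addbT /=
    ?(su, sv, s'u, s'v, sx, sy, s'x, s'y, au, av, ax, ay)
    ?tensvZl ?tensvZr ?scalerA ?li ?scale1r //; congr (_ *: _).
- rewrite -subnDA zetaB // zeta_expm // mul1r exprD invfM mulrAC.
  by rewrite [X in _ = X * _]mulrC li mul1r.
- by ring.
- by rewrite exprD.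
- by ring.
- by rewrite zetaB.
- by ring.
- by rewrite zetaB // -mulrA li' mulr1.
- by ring.
Qed.

(** With equal parameters of [s4 true] and [s4 false] on T, their exchange on
    the first factor is invisible: the rule is uniform in [dlt]. *)
Lemma T_tens_pi i alp dlt eps M N (t : vec M) (u v : vec N) :
  sign dlt -> is_T alp alp eps t -> is_pi dlt i u v ->
  pi_formulas (eps * dlt) i (t \ot u) (alp *: (t \ot v)).
Proof.
move=> sd [_ [st s't at_]] [_ [su sv s'u s'v [au av]]].
have tu b : act (s4 b) (t \ot u) = alp *: (t \ot act (s4 b) u).
  have sE b' : act (s4 b') t = alp *: t by case: b'.
  by case: sd au => -> au; [rewrite (act_tens_s b (d := false) t au)
    | rewrite (act_tens_s b (d := true) t au)]; rewrite sE tensvZl.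
by apply: pi_formulasI => //; rewrite ?tu ?act_tens_a ?(su, s'u, at_, au)
  ?tensvZl ?tensvZr ?scalerA // mulrC.
Qed.

Lemma pi_tens_T1 i alp dlt M N (t : vec N) (u v : vec M) :
  is_T alp alp 1 t -> is_pi dlt i u v ->
  pi_formulas dlt i (u \ot t) (alp *: (v \ot t)).
Proof.
move=> [_ [st s't at_]] [_ [su sv s'u s'v [au av]]].
have tu b w := act_tens_s b (d := false) w at_.
by apply: pi_formulasI => //; rewrite ?tu ?act_tens_a /=
  ?(su, s'u, st, s't, at_, au) ?tensvZl ?tensvZr ?scalerA ?mulr1.
Qed.

Lemma pi_tens_TN1 i alp dlt M N (t : vec N) (u v : vec M) :
  is_T alp alp (-1) t -> is_pi dlt i u v ->
  pi_formulas (- dlt) i (lam ^+ i *: (v \ot t)) (alp *: (u \ot t)).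
Proof.
move=> [_ [st s't at_]] [_ [su sv s'u s'v [au av]]].
have tu b w := act_tens_s b (d := true) w at_.
apply: pi_formulasI => //; rewrite actZ ?tu ?act_tens_a /=
  ?(sv, s'v, st, s't, at_, av) ?tensvZl ?tensvZr ?scalerA //; congr (_ *: _).
- by rewrite mulrA mulfV ?mul1r ?zeta_neq0.
- by ring.
Qed.

Hypothesis m_even : ~~ odd m.

Lemma zeta_halfB i : (i <= m./2)%N -> lam ^+ (m./2 - i) = - lam ^- i.
Proof. by move=> le_im; rewrite zetaB // zeta_half // mulN1r. Qed.

(** Opposite parameters of [s4 true] and [s4 false] on T turn [lam ^+ i] into
    [- lam ^+ i], which swaps the two basis vectors and replaces [i] by
    [m./2 - i]; exchanging the two generators contributes the sign [dlt]. *)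
Lemma Talt_tens_pi i alp dlt eps M N (t : vec M) (u v : vec N) :
  (i <= m./2)%N -> sign alp -> sign dlt ->
  is_T alp (- alp) eps t -> is_pi dlt i u v ->
  pi_formulas (eps * dlt) (m./2 - i) ((alp * dlt) *: (t \ot v)) (t \ot u).
Proof.
move=> le_im /sign_sq sa sd [_ [st s't at_]] [_ [su sv s'u s'v [au av]]].
have /sign_sq dd := sd.
have tu b : act (s4 b) (t \ot v) =
    (alp * dlt * (-1) ^+ (~~ b)) *: (t \ot act (s4 b) v).
  by case: sd av => -> av; [rewrite (act_tens_s b (d := false) t av)
    | rewrite (act_tens_s b (d := true) t av)]; case: b;
    rewrite /= ?st ?s't tensvZl; congr (_ *: _); ring.
have aadd : alp * dlt * (alp * dlt) = 1 by rewrite mulrACA sa dd mulr1.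
apply: pi_formulasI => //; rewrite actZ ?tu ?act_tens_a ?(sv, s'v, at_, av)
  ?tensvZl ?tensvZr ?scalerA //.
- by rewrite mulr1 aadd scale1r.
- by rewrite zeta_halfB // mulrA aadd; congr (_ *: _); ring.
- by congr (_ *: _); ring.
Qed.

Lemma pi_tens_Talt1 i alp dlt M N (t : vec N) (u v : vec M) :
  (i <= m./2)%N -> sign alp -> is_T alp (- alp) 1 t -> is_pi dlt i u v ->
  pi_formulas dlt (m./2 - i) (alp *: (v \ot t)) (u \ot t).
Proof.
move=> le_im /sign_sq sa [_ [st s't at_]] [_ [su sv s'u s'v [au av]]].
have tv b w := act_tens_s b (d := false) w at_.
apply: pi_formulasI => //; rewrite actZ ?tv ?act_tens_a /=
  ?(sv, s'v, st, s't, at_, av) ?tensvZl ?tensvZr ?scalerA //.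
- by rewrite sa scale1r.
- by rewrite zeta_halfB // mulrCA mulrN sa mulrN1.
- by rewrite mulr1 mulrC.
Qed.

Lemma pi_tens_TaltN1 i alp dlt M N (t : vec N) (u v : vec M) :
  (i <= m./2)%N -> sign alp -> is_T alp (- alp) (-1) t -> is_pi dlt i u v ->
  pi_formulas (- dlt) (m./2 - i) (alp *: (u \ot t)) (lam ^+ i *: (v \ot t)).
Proof.
move=> le_im /sign_sq sa [_ [st s't at_]] [_ [su sv s'u s'v [au av]]].
have tu b w := act_tens_s b (d := true) w at_.
apply: pi_formulasI => //; rewrite actZ ?tu ?act_tens_a /=
  ?(su, s'u, st, s't, at_, au) ?tensvZl ?tensvZr ?scalerA //.
- by rewrite mulrCA sa mulr1.
- by rewrite zeta_halfB // mulrN mulNr mulVf ?zeta_neq0 // sa.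
- by congr (_ *: _); ring.
Qed.

Lemma T_tens_T1 c1 c2 c3 d1 d2 M N (t : vec M) (s : vec N) :
  is_T c1 c2 c3 t -> is_T d1 d2 1 s ->
  T_formulas (c1 * d1) (c2 * d2) c3 (t \ot s).
Proof.
move=> [_ [st s't at_]] [_ [ss s's as_]].
have ts b w := act_tens_s b (d := false) w as_.
by split; rewrite ?ts ?act_tens_a /= ?(st, s't, at_, ss, s's, as_) tensvZl
  tensvZr scalerA ?mulr1.
Qed.

Lemma T_tens_TN1 c1 c2 c3 d1 d2 M N (t : vec M) (s : vec N) :
  is_T c1 c2 c3 t -> is_T d1 d2 (-1) s ->
  T_formulas (c2 * d1) (c1 * d2) (- c3) (t \ot s).
Proof.
move=> [_ [st s't at_]] [_ [ss s's as_]].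
have ts b w := act_tens_s b (d := true) w as_.
by split; rewrite ?ts ?act_tens_a /= ?(st, s't, at_, ss, s's, as_) tensvZl
  tensvZr scalerA ?mulrN1.
Qed.

End Named.

(** * The fusion rules *)

Theorem theorem6p3 (R : realType) (m : nat) (hm : (2 <= m)%N)
    (heven : ~~ odd m) :
  let lam := zeta R m in
  (* pi_i^eps (x) pi_j^1 *)
  (forall (i j : nat) (eps : R[i]) (M N : a4mod R[i] m)
      (u v : vec M) (x y : vec N),
    (1 <= i <= m./2 - 1)%N -> (1 <= j <= m./2 - 1)%N -> sign eps ->
    is_pi eps i u v -> is_pi 1 j x y ->
    [/\ ((i + j <= m./2 - 1)%N -> (j <= i)%N ->
          fusion_pi_sum eps (i - j) (u \ot y) (v \ot x)
                        eps (i + j) (u \ot x) (v \ot y)),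
        ((i + j <= m./2 - 1)%N -> (i <= j)%N ->
          fusion_pi_sum eps (j - i) (v \ot x) (u \ot y)
                        eps (i + j) (u \ot x) (v \ot y)),
        ((m./2 - 1 < i + j)%N -> (j <= i)%N ->
          fusion_pi_sum eps (i - j) (u \ot y) (v \ot x)
                        eps (m - i - j) (v \ot y) (u \ot x)) &
        ((m./2 - 1 < i + j)%N -> (i <= j)%N ->
          fusion_pi_sum eps (j - i) (v \ot x) (u \ot y)
                        eps (m - i - j) (v \ot y) (u \ot x))]) /\
  (* pi_i^eps (x) pi_j^(-1) *)
  (forall (i j : nat) (eps : R[i]) (M N : a4mod R[i] m)
      (u v : vec M) (x y : vec N),
    (1 <= i <= m./2 - 1)%N -> (1 <= j <= m./2 - 1)%N -> sign eps ->
    is_pi eps i u v -> is_pi (-1) j x y ->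
    [/\ ((i + j <= m./2 - 1)%N -> (j <= i)%N ->
          fusion_pi_sum (- eps) (i - j) (lam ^+ i *: (v \ot y)) (u \ot x)
                        (- eps) (i + j) (lam ^+ i *: (v \ot x)) (u \ot y)),
        ((i + j <= m./2 - 1)%N -> (i <= j)%N ->
          fusion_pi_sum (- eps) (j - i) (u \ot x) (lam ^+ i *: (v \ot y))
                        (- eps) (i + j) (lam ^+ i *: (v \ot x)) (u \ot y)),
        ((m./2 - 1 < i + j)%N -> (j <= i)%N ->
          fusion_pi_sum (- eps) (i - j) (lam ^+ i *: (v \ot y)) (u \ot x)
                        (- eps) (m - i - j) (u \ot y) (lam ^+ i *: (v \ot x))) &
        ((m./2 - 1 < i + j)%N -> (i <= j)%N ->
          fusion_pi_sum (- eps) (j - i) (u \ot x) (lam ^+ i *: (v \ot y))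
                        (- eps) (m - i - j) (u \ot y) (lam ^+ i *: (v \ot x)))]) /\
  (* T_{alp,alp,eps} (x) pi_i^dlt *)
  (forall (i : nat) (alp dlt eps : R[i]) (M N : a4mod R[i] m)
      (t : vec M) (u v : vec N),
    (1 <= i <= m./2 - 1)%N -> sign alp -> sign dlt -> sign eps ->
    is_T alp alp eps t -> is_pi dlt i u v ->
    fusion_pi (eps * dlt) i (t \ot u) (alp *: (t \ot v))) /\
  (* pi_i^dlt (x) T_{alp,alp,1} *)
  (forall (i : nat) (alp dlt : R[i]) (M N : a4mod R[i] m)
      (t : vec N) (u v : vec M),
    (1 <= i <= m./2 - 1)%N -> sign alp -> sign dlt ->
    is_T alp alp 1 t -> is_pi dlt i u v ->
    fusion_pi dlt i (u \ot t) (alp *: (v \ot t))) /\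
  (* pi_i^dlt (x) T_{alp,alp,-1} *)
  (forall (i : nat) (alp dlt : R[i]) (M N : a4mod R[i] m)
      (t : vec N) (u v : vec M),
    (1 <= i <= m./2 - 1)%N -> sign alp -> sign dlt ->
    is_T alp alp (-1) t -> is_pi dlt i u v ->
    fusion_pi (- dlt) i (lam ^+ i *: (v \ot t)) (alp *: (u \ot t))) /\
  (* T_{alp,-alp,eps} (x) pi_i^dlt *)
  (forall (i : nat) (alp dlt eps : R[i]) (M N : a4mod R[i] m)
      (t : vec M) (u v : vec N),
    (1 <= i <= m./2 - 1)%N -> sign alp -> sign dlt -> sign eps ->
    is_T alp (- alp) eps t -> is_pi dlt i u v ->
    fusion_pi (eps * dlt) (m./2 - i) ((alp * dlt) *: (t \ot v)) (t \ot u)) /\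
  (* pi_i^dlt (x) T_{alp,-alp,1} *)
  (forall (i : nat) (alp dlt : R[i]) (M N : a4mod R[i] m)
      (t : vec N) (u v : vec M),
    (1 <= i <= m./2 - 1)%N -> sign alp -> sign dlt ->
    is_T alp (- alp) 1 t -> is_pi dlt i u v ->
    fusion_pi dlt (m./2 - i) (alp *: (v \ot t)) (u \ot t)) /\
  (* pi_i^dlt (x) T_{alp,-alp,-1} *)
  (forall (i : nat) (alp dlt : R[i]) (M N : a4mod R[i] m)
      (t : vec N) (u v : vec M),
    (1 <= i <= m./2 - 1)%N -> sign alp -> sign dlt ->
    is_T alp (- alp) (-1) t -> is_pi dlt i u v ->
    fusion_pi (- dlt) (m./2 - i) (alp *: (u \ot t)) (lam ^+ i *: (v \ot t))) /\
  (* T (x) T *)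
  (forall (alp bet eps dlt : R[i]) (M N : a4mod R[i] m)
      (t : vec M) (s : vec N),
    sign alp -> sign bet -> sign eps -> sign dlt ->
    [/\ (is_T alp alp eps t -> is_T bet bet dlt s ->
          fusion_T (alp * bet) (alp * bet) (eps * dlt) (t \ot s)),
        (is_T alp (- alp) eps t -> is_T bet (- bet) dlt s ->
          fusion_T (alp * bet * dlt) (alp * bet * dlt) (eps * dlt) (t \ot s)),
        (is_T alp alp eps t -> is_T bet (- bet) dlt s ->
          fusion_T (alp * bet) (- (alp * bet)) (eps * dlt) (t \ot s)) &
        (is_T alp (- alp) eps t -> is_T bet bet dlt s ->
          fusion_T (alp * bet * dlt) (- (alp * bet * dlt)) (eps * dlt)
                   (t \ot s))]).
Proof.
have m_gt0 : (0 < m)%N by apply: leq_trans hm.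
have lt_half i : (1 <= i <= m./2 - 1)%N -> (i < m./2)%N.
  by case/andP; case: (m./2) => [|h]; [case: i | rewrite subn1].
have le_half i (ri : (1 <= i <= m./2 - 1)%N) := ltnW (lt_half i ri).
have sign_neq0 (c : R[i]) : sign c -> c != 0.
  by case=> ->; rewrite ?oppr_eq0 oner_eq0.
have le_addm i j : (1 <= i <= m./2 - 1)%N -> (1 <= j <= m./2 - 1)%N ->
    (i + j <= m)%N.
  move=> /le_half le_i /le_half le_j; apply: leq_trans (leq_add le_i le_j) _.
  by rewrite addnn -[leqRHS]odd_double_half leq_addl.
move=> lam; have lam_neq0 i : lam ^+ i != 0 by apply: zeta_neq0.
do ?refine (conj _ _).
- move=> i j eps M N u v x y ri rj _ piM piN.
  have [/(_ (le_addm i j ri rj)) f1 f2 f3 f4] := pi_tens_pi1 m_gt0 piM piN.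
  have bas : basis_of fullv [:: u \ot x; u \ot y; v \ot x; v \ot y].
    exact: basis_tensmx piM.1 piN.1.
  by split=> _ le_ij; apply: fusion_pi_sumI; auto; apply: (basis_perm bas);
    apply/permP => p /=; ring.
- move=> i j eps M N u v x y ri rj _ piM piN.
  have [/(_ (le_addm i j ri rj)) f1 f2 f3 f4] := pi_tens_piN1 m_gt0 piM piN.
  have bas : basis_of fullv [:: lam ^+ i *: (v \ot x); u \ot x;
                                lam ^+ i *: (v \ot y); u \ot y].
    apply: basis_scale => //.
    apply: (@basis_perm _ _ _
        [:: lam ^+ i *: (v \ot y); u \ot x; u \ot y; v \ot x]); last first.
      by apply/permP => p /=; ring.
    apply: basis_scale => //.
    apply: (basis_perm (basis_tensmx piM.1 piN.1)).
    by apply/permP => p /=; ring.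
  by split=> _ le_ij; apply: fusion_pi_sumI; auto; apply: (basis_perm bas);
    apply/permP => p /=; ring.
- move=> i alp dlt eps M N t u v _ sa sd _ TM piN.
  apply: fusion_piI; last exact: T_tens_pi.
  apply/basis_swap/basis_scale/basis_swap; first exact: sign_neq0.
  exact: basis_tensmx TM.1 piN.1.
- move=> i alp dlt M N t u v _ sa _ TN piM.
  apply: fusion_piI; last exact: pi_tens_T1.
  apply/basis_swap/basis_scale/basis_swap; first exact: sign_neq0.
  exact: basis_tensmx piM.1 TN.1.
- move=> i alp dlt M N t u v _ sa _ TN piM.
  apply: fusion_piI; last exact: pi_tens_TN1.
  apply: basis_scale => //.
  apply/basis_swap/basis_scale; first exact: sign_neq0.
  exact: basis_tensmx piM.1 TN.1.
- move=> i alp dlt eps M N t u v ri sa sd _ TM piN.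
  apply: fusion_piI; last exact: (Talt_tens_pi m_gt0 heven (le_half i ri)).
  apply: basis_scale; first by rewrite mulf_neq0 ?sign_neq0.
  apply: basis_swap; exact: basis_tensmx TM.1 piN.1.
- move=> i alp dlt M N t u v ri sa _ TN piM.
  apply: fusion_piI; last exact: (pi_tens_Talt1 m_gt0 heven (le_half i ri)).
  apply: basis_scale; first exact: sign_neq0.
  apply: basis_swap; exact: basis_tensmx piM.1 TN.1.
- move=> i alp dlt M N t u v ri sa _ TN piM.
  apply: fusion_piI; last exact: (pi_tens_TaltN1 m_gt0 heven (le_half i ri)).
  apply: basis_scale; first exact: sign_neq0.
  apply/basis_swap/basis_scale/basis_swap => //.
  exact: basis_tensmx piM.1 TN.1.
- move=> alp bet eps dlt M N t s _ _ _ sd.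
  split=> TM TN; apply: fusion_TI (basis_tensmx TM.1 TN.1) _;
    case: sd TN => -> TN.
  + by have := T_tens_T1 TM TN; rewrite mulr1.
  + by have := T_tens_TN1 TM TN; rewrite mulrN1.
  + by have := T_tens_T1 TM TN; rewrite mulrNN !mulr1.
  + by have := T_tens_TN1 TM TN; rewrite mulrN mulNr !mulrN1.
  + by have := T_tens_T1 TM TN; rewrite mulrN mulr1.
  + by have := T_tens_TN1 TM TN; rewrite mulrN mulrN1.
  + by have := T_tens_T1 TM TN; rewrite mulNr !mulr1.
  + by have := T_tens_TN1 TM TN; rewrite mulNr !mulrN1 opprK.
Qed.
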